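(* Let $a\ge 1$ and $b$ be integers. Then the set $\{\,s(n)-n : n=aj+b \text{ for some integer } j\ge 0,\ n\ge 0\,\}$ is unbounded.
   Context: For integers $m\ge 0$, $k\ge0$ let $\operatorname{bit}_k(m)=\lfloor m/2^k\rfloor\bmod 2$. For $n\ge 0$ the sloping binary number is $s(n)=\sum_{k\ge 0}\operatorname{bit}_k(n+k)2^k$ (the $2^k$ digit of $s(n)$ is the $2^k$ digit of $n+k$). *)

(* Defs.v *)
From mathcomp Require Import all_boot all_order all_algebra.

Set Implicit Arguments.
Unset Strict Implicit.
Unset Printing Implicit Defensive.

Import Order.TTheory GRing.Theory Num.Theory.

Definition bit (k m : nat) : nat := (m %/ 2 ^ k) %% 2.

(* The sum defining the sloping binary number s(n) runs over all k >= 0; its  *)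
(* terms vanish for k > n (bit_sloping_eq0), so it is truncated at k = n, and *)
(* sloping_widen shows that any later truncation gives the same value.        *)
Definition sloping (n : nat) : nat := \sum_(0 <= k < n.+1) bit k (n + k) * 2 ^ k.

Lemma bit_sloping_eq0 (n k : nat) : n < k -> bit k (n + k) = 0.
Proof.
move=> lt_nk; rewrite /bit divn_small ?mod0n //.
case: k lt_nk => // k; rewrite ltnS => le_nk.
apply: (@leq_trans k.+1.*2).
  by rewrite -addnn ltn_add2r ltnS.
by rewrite expnS mul2n leq_double ltn_expl.
Qed.

Lemma sloping_widen (n N : nat) :
  n < N -> sloping n = \sum_(0 <= k < N) bit k (n + k) * 2 ^ k.
Proof.
move=> lt_nN; rewrite [RHS](big_cat_nat (n := n.+1)) //= -/(sloping n).
rewrite [X in _ = _ + X]big_nat_cond big1 ?addn0 // => k.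
by rewrite andbT => /andP[lt_nk _]; rewrite bit_sloping_eq0.
Qed.

Local Open Scope ring_scope.

Definition unbounded (A : int -> Prop) : Prop :=
  forall M : int, exists2 x : int, A x & M < `|x|.

(* Main.v *)
Require Import Defs.
From mathcomp Require Import all_boot all_order all_algebra.
From mathcomp Require Import zify.

(* Adding up the digits of [s(n)] telescopes to [n] plus the sum of [2 ^ k]   *)
(* over the [k >= 1] for which [2 ^ k] divides [n + k].  It thus suffices to  *)
(* find [n] in the progression with [2 ^ k] dividing [n + k] for a large [k]. *)
(* If [k = a c - b], then [n = a c 2 ^ k - k = a c (2 ^ k - 1) + b] is such.  *)

Import Order.TTheory GRing.Theory Num.Theory.
Local Open Scope ring_scope.

(** The telescoping rests on [bit_modn]: the term of index [k] is [n + k] mod [2 ^ k.+1] minus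
    [n + k] mod [2 ^ k]. Passing to [n + k.+1] raises the first residue by 1, unless it wraps to 0;
    each wrap, at a multiple of [2 ^ k.+1], leaves an excess [2 ^ k.+1]. [sloping_eq] records the
    total, and [leq_sloping] keeps one excess. *)

Lemma bit_modn (k m : nat) : (bit k m * 2 ^ k + m %% 2 ^ k = m %% 2 ^ k.+1)%N.
Proof.
rewrite /bit; have q0 : (0 < 2 ^ k)%N by rewrite expn_gt0.
have def_m : m = (m %/ 2 ^ k %/ 2 * 2 ^ k.+1 +
    (m %/ 2 ^ k %% 2 * 2 ^ k + m %% 2 ^ k))%N.
  by rewrite expnS mulnA addnA -mulnDl -divn_eq -divn_eq.
rewrite [in RHS]def_m modnMDl [RHS]modn_small //.
have := ltn_pmod m q0; have := ltn_pmod (m %/ 2 ^ k) (isT : 0 < 2)%N.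
by rewrite expnS {def_m}; case: (_ %% 2)%N => [|[|//]] _; lia.
Qed.

(* [K] is added on the left to avoid a truncated subtraction. *)
Lemma sloping_partial_sum (n K : nat) :
  (\sum_(0 <= k < K) bit k (n + k) * 2 ^ k + K =
   (n + K) %% 2 ^ K + \sum_(1 <= k < K.+1 | 2 ^ k %| n + k) 2 ^ k)%N.
Proof.
elim: K => [|K IH]; first by rewrite !big_geq // expn0 modn1.
rewrite big_nat_recr //= [in RHS]big_mkcond big_nat_recr //= -big_mkcond /=.
have := bit_modn K (n + K); rewrite !addnS modnS.
case: ifP => [dv|_]; last by lia.
have := modnS (n + K) (2 ^ K.+1); rewrite dv => m0.
(* At a wrap the previous residue is maximal. *)
have : ((n + K) %% 2 ^ K.+1).+1 = (2 ^ K.+1)%N.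
  have p0 : (0 < 2 ^ K.+1)%N by rewrite expn_gt0.
  apply/eqP; rewrite eqn_leq ltn_pmod // dvdn_leq //.
  by rewrite /dvdn -addn1 modnDml addn1.
by lia.
Qed.

Lemma sloping_eq (n : nat) :
  sloping n = (n + \sum_(1 <= k < n.+2 | 2 ^ k %| n + k) 2 ^ k)%N.
Proof.
(* With [K = n.+1] the residue is [n + K] itself, as [2 n + 1 < 2 ^ n.+1]. *)
have := sloping_partial_sum n n.+1; rewrite -/(sloping n) modn_small; first by lia.
by have := ltn_expl n (isT : 1 < 2)%N; rewrite expnS; lia.
Qed.

Lemma leq_sloping (n k : nat) :
  (0 < k)%N -> (2 ^ k %| n + k)%N -> (n + 2 ^ k <= sloping n)%N.
Proof.
move=> k0 dv; rewrite sloping_eq leq_add2l.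
have k_le : (k < n.+2)%N.
  have /(dvdn_leq _) := dv; rewrite addn_gt0 k0 orbT => /(_ isT).
  case: k k0 {dv} => // k _; rewrite expnS.
  by have := ltn_expl k (isT : 1 < 2)%N; lia.
rewrite (big_rem k) ?mem_index_iota ?k0 //= dv.
exact: leq_addr.
Qed.

Theorem theorem4 (a b : int) (ha : 1 <= a) :
  unbounded (fun x : int =>
    exists (n : nat) (j : int),
      [/\ 0 <= j, n%:Z = a * j + b & x = (sloping n)%:Z - n%:Z]).
Proof.
move=> M; case: a ha => // a a1.
(* As [a >= 1], this makes [k = a c - b] exceed [|M|]; then the excess [2 ^ k > k] does too. *)
pose c := (`|b| + `|M| + 1)%N.
have [k def_k] : exists k : nat, k%:Z = a%:Z * c%:Z - b.
  by exists `|(a%:Z * c%:Z - b)%R|%N; rewrite gez0_abs //; nia.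
have Mk : `|M|%:Z < k%:Z by rewrite def_k; nia.
have k_lt := ltn_expl k (isT : 1 < 2)%N.
have ac1 : (0 < a * c)%N by nia.
have k_le : (k <= a * c * 2 ^ k)%N by nia.
pose n := (a * c * 2 ^ k - k)%N.
have dv : (2 ^ k %| n + k)%N by rewrite subnK // dvdn_mull.
have k0 : (0 < k)%N by lia.
have le_s := leq_sloping _ _ k0 dv.
exists ((sloping n)%:Z - n%:Z); last by lia.
exists n, (c%:Z * (2 ^ k - 1)%N%:Z); split=> //.
rewrite /n; move: (2 ^ k)%N k_lt k_le {dv le_s n} => p; nia.
Qed.
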